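(* Let $n \geq 2$ be an integer and let $x_1 > x_2 > \cdots > x_n$ be arbitrary real numbers. Let Player 2 play the $n$-number guessing game described in the context using the following strategy: at each stage $k \in \{1, \ldots, n-1\}$, Player 2 guesses $c_{k+1}$ by drawing a sample from the categorical distribution $f_k\left(x_{\sigma^{-1}(1)}, \ldots, x_{\sigma^{-1}(k)}\right)$ on $\{0, \ldots, k\}$, where for pairwise distinct reals $\eta_1, \ldots, \eta_k$, $$f_k(\eta_1, \ldots, \eta_k) = \frac{\left(1, e^{\eta_{\sigma_k(1)}}, \ldots, e^{\eta_{\sigma_k(k)}}\right)}{1 + e^{\eta_{\sigma_k(1)}} + \cdots + e^{\eta_{\sigma_k(k)}}} \in \Delta^k,$$ and $\sigma_k \in \mathbf{S}_k$ is the unique permutation for which $\eta_{\sigma_k(1)} > \cdots > \eta_{\sigma_k(k)}$. Then this strategy is dominant for Player 2, i.e. for every choice of $x_1 > \cdots > x_n$ Player 2 wins with probability strictly greater than $\frac{1}{n!}$. Equivalently, $$\sum_{\sigma \in \mathbf{S}_n} \frac{1}{n!} \prod_{k=1}^{n-1} f_k\left(x_{\sigma^{-1}(1)}, \ldots, x_{\sigma^{-1}(k)}\right)(c_{k+1}) > \frac{1}{n!},$$ where for each $\sigma \in \mathbf{S}_n$, $(c_1, \ldots, c_n)$ denotes the Lehmer code of $\sigma$.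
   Context: $\mathbf{S}_n$ is the group of bijections of $\{1, \ldots, n\}$. Lehmer code: the Lehmer code of $\sigma \in \mathbf{S}_n$ is the tuple $(c_1, \ldots, c_n)$ with $c_1 = 0$ and, for $k \in \{1, \ldots, n-1\}$, $$c_{k+1} = \left|\left\{ i \in \{1, \ldots, k\} \mid \sigma^{-1}(i) < \sigma^{-1}(k+1) \right\}\right| \in \{0, \ldots, k\}.$$ Simplex: $\Delta^k = \left\{(p_0, \ldots, p_k) \in \mathbb{R}^{k+1} \mid \sum_{i=0}^k p_i = 1,\ p_i \geq 0 \text{ for all } i\right\}$. Elements of $\Delta^k$ are identified with categorical distributions on $\{0, \ldots, k\}$. For $p = (p_0, \ldots, p_k) \in \Delta^k$ and $j \in \{0, \ldots, k\}$, $p(j) = p_j$ (coordinates are indexed starting from $0$). Game: Player 1 (an adversary) chooses $n$ distinct real numbers, written $x_1 > \cdots > x_n$, on separate slips. The slips are revealed to Player 2 one at a time in uniformly random order, so that the numbers in order of revelation are $x_{\sigma^{-1}(1)}, \ldots, x_{\sigma^{-1}(n)}$ with $\sigma$ uniformly distributed on $\mathbf{S}_n$. At stage $k \in \{1, \ldots, n-1\}$, the numbers $x_{\sigma^{-1}(1)}, \ldots, x_{\sigma^{-1}(k)}$ are visible to Player 2, who must guess the ordinal position of the next number $x_{\sigma^{-1}(k+1)}$ with respect to the visible ones, i.e. must guess the entry $c_{k+1}$ of the Lehmer code of $\sigma$. That number is then revealed, and the game continues only if the guess was correct. Player 2 wins if all $n-1$ guesses are correct, i.e. if he completely reconstructs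 $\sigma$. The random samples used at different stages are drawn independently given $\sigma$. A strategy is called dominant for Player 2 if, for every choice of distinct real numbers by Player 1, Player 2 wins with probability strictly greater than $\frac{1}{n!}$. *)

(* Defs.v *)
From HB Require Import structures.
From mathcomp Require Import all_boot all_order all_algebra all_fingroup.
From mathcomp Require Import reals sequences exp.

Set Implicit Arguments.
Unset Strict Implicit.
Unset Printing Implicit Defensive.

Import Order.TTheory GRing.Theory Num.Theory.
Local Open Scope ring_scope.

(* Indices are 0-based: the positions 1, ..., n are the elements of ['I_n], so
   that 'S_n is the group of bijections of ['I_n], and [k : 'I_n] stands for the
   position k + 1, that is, for the first number not yet revealed at stage k. *)

Lemma lehmer_subproof n (s : 'S_n) (k : 'I_n) :
  (#|[set i : 'I_n | (i < k)%N && ((s^-1)%g i < (s^-1)%g k)%N]| < k.+1)%N.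
Proof.
rewrite ltnS.
have -> : [set i : 'I_n | (i < k)%N && ((s^-1)%g i < (s^-1)%g k)%N] =
    widen_ord (ltnW (ltn_ord k)) @:
      [set j : 'I_k | ((s^-1)%g (widen_ord (ltnW (ltn_ord k)) j)
                       < (s^-1)%g k)%N].
  apply/setP => i; rewrite inE; apply/andP/imsetP => [[ik lt]|[j]].
    have E : i = widen_ord (ltnW (ltn_ord k)) (Ordinal ik) by apply: val_inj.
    by exists (Ordinal ik); rewrite // inE -E.
  by rewrite inE => lt ->; split=> //=; exact: ltn_ord.
apply: leq_trans (leq_imset_card _ _) _.
by apply: leq_trans (max_card _) _; rewrite card_ord.
Qed.

(* [lehmer s k] is the entry c_{k+1} of the Lehmer code. *)
Definition lehmer n (s : 'S_n) (k : 'I_n) : 'I_k.+1 :=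
  Ordinal (lehmer_subproof s k).

(* The simplex Δ^k, i.e. the categorical distributions on {0, ..., k}. *)
Definition in_simplex (R : realType) k (p : {ffun 'I_k.+1 -> R}) : bool :=
  [forall i, 0 <= p i] && (\sum_(i < k.+1) p i == 1).

Record simplex (R : realType) k := Simplex {
  simplex_val :> {ffun 'I_k.+1 -> R};
  simplexP : in_simplex simplex_val }.

(* Player 2's behaviour at stage k depends only on the k visible numbers, in
   their order of revelation. The game only uses a strategy at stages
   1 <= k < n and on pairwise distinct numbers. *)
Definition strategy (R : realType) := forall k, ('I_k -> R) -> simplex R k.

Definition strictly_decreasing (R : realType) n (x : 'I_n -> R) : Prop :=
  forall i j : 'I_n, (i < j)%N -> x j < x i.

Definition visible (R : realType) n (x : 'I_n -> R) (s : 'S_n) (k : 'I_n) :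
    'I_k -> R :=
  fun i => x ((s^-1)%g (widen_ord (ltnW (ltn_ord k)) i)).
Arguments visible {R n} x s k _.

Definition stage n := {k : 'I_n | (0 < k)%N}.

Definition guesses n := fprod (fun k : stage n => 'I_(val k).+1).

(* Joint law of the uniform permutation and of the guesses, which are
   independent given the permutation. Guesses are drawn at every stage; those
   following a wrong guess are immaterial, since the game is then lost. *)
Definition game_law (R : realType) (f : strategy R) n (x : 'I_n -> R)
    (s : 'S_n) (g : guesses n) : R :=
  (n`!%:R)^-1 * \prod_(k : stage n) f _ (visible x s (val k)) (g k).

Definition wins n (s : 'S_n) (g : guesses n) : bool :=
  [forall k : stage n, g k == lehmer s (val k)].

Definition win_prob (R : realType) (f : strategy R) n (x : 'I_n -> R) : R :=
  \sum_(s : 'S_n) \sum_(g : guesses n | wins s g) game_law f x s g.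

Definition dominant (R : realType) (f : strategy R) n : Prop :=
  forall x : 'I_n -> R, strictly_decreasing x -> (n`!%:R)^-1 < win_prob f x.

Lemma game_law_ge0 (R : realType) (f : strategy R) n (x : 'I_n -> R) s g :
  0 <= game_law f x s g.
Proof.
rewrite mulr_ge0 ?invr_ge0 ?ler0n //; apply: prodr_ge0 => k _.
by have /andP[/forallP] := simplexP (f _ (visible x s (val k))).
Qed.

Lemma game_law_sum1 (R : realType) (f : strategy R) n (x : 'I_n -> R) :
  \sum_(s : 'S_n) \sum_(g : guesses n) game_law f x s g = 1.
Proof.
rewrite (eq_bigr (fun _ => (n`!%:R)^-1)) => [|s _]; last first.
  rewrite -mulr_sumr -[RHS]mulr1; congr (_ * _).
  pose P (k : stage n) : {ffun 'I_(val k).+1 -> R} := f _ (visible x s (val k)).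
  have /= -> := big_fprod 1 +%R P.
  rewrite -(bigA_distr_big_dep _ (fun i j => untag 0 (P i) j)) /=.
  apply: big1 => k _.
  have /andP[_ /eqP <-] := simplexP (f _ (visible x s (val k))).
  by rewrite (big_tag (fun i => P i) k).
by rewrite sumr_const card_Sn -[_ *+ _]mulr_natl divff // pnatr_eq0 -lt0n fact_gt0.
Qed.

Definition sorts (R : realType) k (eta : 'I_k -> R) (t : 'S_k) : bool :=
  [forall i : 'I_k, forall j : 'I_k, (i < j)%N ==> (eta (t j) < eta (t i))].

Lemma sorts_uniq (R : realType) k (eta : 'I_k -> R) (t u : 'S_k) :
  sorts eta t -> sorts eta u -> t = u.
Proof.
have mono (v : 'S_k) : sorts eta v ->
    forall i j : 'I_k, (eta (v j) < eta (v i)) = (i < j)%N.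
  move=> /forallP sv i j; case: (ltngtP i j) => [ij|ji|/val_inj ->].
  - by have /forallP /(_ j) /implyP /(_ ij) := sv i.
  - apply/negbTE; rewrite -leNgt; apply: ltW.
    by have /forallP /(_ i) /implyP /(_ ji) := sv j.
  - by rewrite ltxx.
have rank (v : 'S_k) : sorts eta v ->
    forall i, #|[set a | eta (v i) < eta a]| = i.
  move=> sv i.
  have -> : [set a | eta (v i) < eta a] = v @: [set j : 'I_k | (j < i)%N].
    apply/setP => a; rewrite inE -[a](permKV v) mem_imset; last exact: perm_inj.
    by rewrite inE mono.
  rewrite card_imset; last exact: perm_inj.
  rewrite -[RHS](card_ord i).
  have -> : [set j : 'I_k | (j < i)%N] = widen_ord (ltnW (ltn_ord i)) @: setT.
    apply/setP => j; rewrite inE; apply/idP/imsetP => [ji|[a _ ->]].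
      by exists (Ordinal ji) => //; apply: val_inj.
    exact: (ltn_ord a).
  by rewrite card_imset ?cardsT // => a b /(congr1 val) /= /val_inj.
move=> st su; apply/permP => i.
suff : (u^-1)%g (t i) = i by move=> {2}<-; rewrite permKV.
by apply: val_inj; rewrite /= -(rank t st i) -[in LHS](rank u su _) permKV.
Qed.

(* The permutation σ_k of the strategy; by [sorting_permP] and [sorts_uniq] it
   is the unique one satisfying [sorts] when the numbers are distinct. *)
Definition sorting_perm (R : realType) k (eta : 'I_k -> R) : 'S_k :=
  odflt 1%g [pick t | sorts eta t].

Lemma sorting_permP (R : realType) k (eta : 'I_k -> R) :
  injective eta -> sorts eta (sorting_perm eta).
Proof.
move=> eta_inj; rewrite /sorting_perm; case: pickP => //= nosort.
pose r : rel 'I_k := fun i j => eta j <= eta i.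
pose l := sort r (enum 'I_k).
have tr : transitive r by move=> j i m /[swap]; exact: le_trans.
have rtot : total r by move=> i j; exact: le_total.
have sl : size l = k by rewrite size_sort size_enum_ord.
have ul : uniq l by rewrite sort_uniq enum_uniq.
pose h (i : 'I_k) := nth i l i.
have hinj : injective h.
  move=> i j; rewrite /h (set_nth_default i j) ?sl // => /eqP.
  by rewrite nth_uniq ?sl // => /eqP /val_inj.
have := nosort (perm hinj); case/negP.
apply/forallP => i; apply/forallP => j; apply/implyP => ij.
rewrite !permE lt_neqAle (inj_eq eta_inj) (inj_eq hinj).
rewrite -val_eqE gtn_eqF //= /h (set_nth_default i j) ?sl //.
have refl_r : reflexive r by move=> a; exact: lexx.
apply: (sorted_leq_nth tr refl_r i (sort_sorted rtot _)).
- by rewrite inE sl.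
- by rewrite inE sl.
- exact: ltnW.
Qed.

(* [unlift ord0 j] is [None] at the coordinate j = 0, of weight 1, and [Some i]
   at the coordinate j = i + 1, of weight e^(eta_(σ_k(i + 1))) in 1-based
   notation. *)
Definition exp_dist (R : realType) k (eta : 'I_k -> R) : {ffun 'I_k.+1 -> R} :=
  [ffun j => oapp (fun i => expR (eta (sorting_perm eta i))) 1 (unlift ord0 j)
             / (1 + \sum_(i < k) expR (eta (sorting_perm eta i)))].

Lemma exp_dist_in_simplex (R : realType) k (eta : 'I_k -> R) :
  in_simplex (exp_dist eta).
Proof.
have D0 : 0 < 1 + \sum_(i < k) expR (eta (sorting_perm eta i)).
  by rewrite ltr_pwDl // sumr_ge0 // => i _; exact: expR_ge0.
apply/andP; split.
  apply/forallP => j; rewrite ffunE divr_ge0 ?(ltW D0) //.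
  by case: unlift => [i|] //=; exact: expR_ge0.
under eq_bigr do rewrite ffunE.
rewrite -mulr_suml big_ord_recl unlift_none /=.
rewrite (eq_bigr (fun i => expR (eta (sorting_perm eta i)))) => [|i _].
  by rewrite divff // gt_eqF.
by rewrite liftK.
Qed.

Definition exp_strategy (R : realType) : strategy R :=
  fun k eta => Simplex (exp_dist_in_simplex eta).

(* Main.v *)
(* Put a_0 = 1 and a_i = e^(x_i), and let S be n! times the winning probability.
   Conditioning on the rank m of the last revealed number gives
     S(x_1, ..., x_n) = sum_m S(x without x_m) * a_(m-1) / (T - a_m),
   where T = a_0 + ... + a_n. By induction the first factors are >= 1; as
   T - a_m <= T - a_n, the sum is at least (a_0 + ... + a_(n-1)) / (T - a_n) = 1,
   and for n >= 2 the term m = 1 makes the inequality strict. *)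

Require Import Defs.
From HB Require Import structures.
From mathcomp Require Import all_boot all_order all_algebra all_fingroup.
From mathcomp Require Import boolp reals sequences exp.

Set Implicit Arguments.
Unset Strict Implicit.
Unset Printing Implicit Defensive.

Import Order.TTheory GRing.Theory Num.Theory.
Local Open Scope ring_scope.

(** In [lift_perm m ord_max s] the number of index [m] is revealed last and the others come in the
    order [s]. These permutations are pairwise distinct, and counting them gives (n+1) n! = (n+1)!,
    so none is missed. *)
Lemma sum_lift_perm (V : nmodType) n (F : 'S_n.+1 -> V) :
  \sum_s F s = \sum_(m < n.+1) \sum_(s : 'S_n) F (lift_perm m ord_max s).
Proof.
pose h (p : 'I_n.+1 * 'S_n) := lift_perm p.1 ord_max p.2.
have h_inj : injective h.
  move=> [m s] [m' s'] /= E.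
  have Em : m = m'.
    by apply: (perm_inj (s := h (m, s))); rewrite [in RHS]E /h /= !lift_perm_id.
  congr pair => //; apply/permP => i; apply: (@lift_inj _ ord_max).
  by rewrite -!(lift_perm_lift m) -/(h (m, s)) E Em.
rewrite pair_big (reindex h) //=.
apply: onW_bij; apply: inj_card_bij => //.
by rewrite card_prod !card_Sn card_ord factS.
Qed.

(** The hypothesis is an equality in [nat], so that it holds however [i] is embedded, in particular
    by [widen_ord]. *)
Lemma lift_perm_maxV n (m : 'I_n.+1) (s : 'S_n) (i : 'I_n) (j : 'I_n.+1) :
  j = i :> nat -> ((lift_perm m ord_max s)^-1)%g j = lift m ((s^-1)%g i).
Proof.
move=> ji; rewrite lift_permV -(lift_perm_lift ord_max m).
by congr (fun_of_perm _ _); apply: val_inj; rewrite [RHS]lift_max.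
Qed.

(** [lift m] is increasing, so comparisons among the first n revealed numbers are preserved. *)
Lemma lehmer_lift_perm n (m : 'I_n.+1) (s : 'S_n) (k : 'I_n) :
  lehmer (lift_perm m ord_max s) (widen_ord (leqnSn n) k) = lehmer s k.
Proof.
apply: val_inj; rewrite /= -!sum1dep_card big_mkcond big_ord_recr /=.
rewrite ltnNge ltnW ?ltn_ord // addn0 [RHS]big_mkcond /=.
apply: eq_bigr => i _.
have E (j : 'I_n) := @lift_perm_maxV n m s j (widen_ord (leqnSn n) j) erefl.
by rewrite !E ![((lift m _ < _)%N)]ltnNge leq_bump2 -ltnNge.
Qed.

(** All other numbers are visible at the last stage, and exactly [m] of them have a smaller
    index. *)
Lemma lehmer_lift_perm_max n (m : 'I_n.+1) (s : 'S_n) :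
  lehmer (lift_perm m ord_max s) ord_max = m.
Proof.
apply: val_inj => /=; set t := lift_perm m ord_max s.
have tm : t m = ord_max by rewrite /t lift_perm_id.
rewrite -tm permK.
have -> : [set i : 'I_n.+1 | (i < n)%N && ((t^-1)%g i < m)%N] =
    t @: [set j : 'I_n.+1 | (j < m)%N].
  apply/setP => i; rewrite inE -[i](permKV t); move: ((t^-1)%g i) => j.
  rewrite mem_imset ?inE ?permK; last exact: perm_inj.
  (* The bound [t j < n] fails only at [j = m]. *)
  apply: andb_idl => jm; rewrite ltn_neqAle leq_ord andbT.
  have -> : (t j != n :> nat) = (t j != t m) by rewrite tm.
  by rewrite (inj_eq perm_inj) -val_eqE ltn_eqF.
rewrite card_imset; last exact: perm_inj.
rewrite -sum1dep_card -(big_ord_widen n.+1 (fun=> 1%N)).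
  by rewrite sum1_card card_ord.
exact/ltnW/ltn_ord.
Qed.

Lemma visible_lift_perm (R : realType) n (x : 'I_n.+1 -> R) (m : 'I_n.+1)
    (s : 'S_n) (k : 'I_n) :
  visible x (lift_perm m ord_max s) (widen_ord (leqnSn n) k) =
  visible (x \o lift m) s k.
Proof. by apply: funext => i; congr (x _); exact: lift_perm_maxV. Qed.

Lemma visible_lift_perm_max (R : realType) n (x : 'I_n.+1 -> R) (m : 'I_n.+1)
    (s : 'S_n) :
  visible x (lift_perm m ord_max s) ord_max = x \o lift m \o (s^-1)%g.
Proof. by apply: funext => i; congr (x _); exact: lift_perm_maxV. Qed.

Lemma sorting_perm_eq (R : realType) k (eta : 'I_k -> R) (t : 'S_k) :
  sorts eta t -> sorting_perm eta = t.
Proof.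
move=> st; rewrite /sorting_perm; case: pickP => [u su|/(_ t)]; last by rewrite st.
exact: sorts_uniq su st.
Qed.

Lemma strictly_decreasing_lift (R : realType) n (x : 'I_n.+1 -> R) m :
  strictly_decreasing x -> strictly_decreasing (x \o lift m).
Proof. by move=> xd i j ij; apply: xd; rewrite /= ltnNge leq_bump2 -ltnNge. Qed.

(* In the notation of the header, [exp_weight x m] is a_(m-1) and
   [exp_total (x \o lift m)] is T - a_m, with 1-based m. *)
Definition exp_weight (R : realType) n (x : 'I_n.+1 -> R) (m : 'I_n.+1) : R :=
  oapp (fun i => expR (x (lift ord_max i))) 1 (unlift ord0 m).

Definition exp_total (R : realType) n (x : 'I_n -> R) : R :=
  1 + \sum_i expR (x i).

Lemma exp_total_gt0 (R : realType) n (x : 'I_n -> R) : 0 < exp_total x.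
Proof. by rewrite ltr_pwDl // sumr_ge0 // => i _; exact: expR_ge0. Qed.

Lemma exp_weight_gt0 (R : realType) n (x : 'I_n.+1 -> R) m : 0 < exp_weight x m.
Proof. by rewrite /exp_weight; case: unlift => [i|] //=; exact: expR_gt0. Qed.

Lemma sum_exp_weight (R : realType) n (x : 'I_n.+1 -> R) :
  \sum_m exp_weight x m = exp_total (x \o lift ord_max).
Proof.
rewrite big_ord_recl /exp_weight unlift_none; congr (_ + _).
by apply: eq_bigr => i _; rewrite liftK.
Qed.

(** The visible numbers are [x \o lift m] permuted by the inverse of [s], so [s] itself sorts
    them. *)
Lemma exp_strategy_last (R : realType) n (x : 'I_n.+1 -> R) (m : 'I_n.+1)
    (s : 'S_n) : strictly_decreasing x ->
  exp_strategy (visible x (lift_perm m ord_max s) ord_max)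
    (lehmer (lift_perm m ord_max s) ord_max) =
  exp_weight x m / exp_total (x \o lift m).
Proof.
move=> xd; rewrite lehmer_lift_perm_max visible_lift_perm_max /= ffunE.
rewrite (@sorting_perm_eq _ _ _ s) /=; last first.
  apply/forallP => i; apply/forallP => j; apply/implyP => ij /=.
  by rewrite !permK; apply: strictly_decreasing_lift.
congr (_ / (_ + _)); last by apply: eq_bigr => i _; rewrite permK.
rewrite /exp_weight; case: unliftP => [i ->|->] //=.
(* Here [m] is [i] + 1, so [lift m] leaves the index [i] unchanged. *)
rewrite permK; congr (expR (x _)); apply: val_inj.
by rewrite [RHS]lift_max /= /bump add1n ltnn.
Qed.

(** This is S, that is n! times the winning probability. The trivial factor at [k = 0] is kept, so
    that the product runs over all of ['I_n] and its last factor splits off directly. *)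
Definition success_sum (R : realType) n (x : 'I_n -> R) : R :=
  \sum_(s : 'S_n) \prod_(k < n) exp_strategy (visible x s k) (lehmer s k).

(** The last factor does not depend on [s]; the others are those of the game without [x m]. *)
Lemma success_sum_recr (R : realType) n (x : 'I_n.+1 -> R) :
  strictly_decreasing x ->
  success_sum x = \sum_m success_sum (x \o lift m) *
                         (exp_weight x m / exp_total (x \o lift m)).
Proof.
move=> xd; rewrite /success_sum sum_lift_perm; apply: eq_bigr => m _.
rewrite mulr_suml; apply: eq_bigr => s _.
rewrite big_ord_recr exp_strategy_last //; congr (_ * _).
by apply: eq_bigr => k _; rewrite visible_lift_perm lehmer_lift_perm.
Qed.

(** Termwise, since [lift ord_max i] has value [i], which is at most [lift m i]. *)
Lemma exp_total_lift_le (R : realType) n (x : 'I_n.+1 -> R) m :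
  strictly_decreasing x ->
  exp_total (x \o lift m) <= exp_total (x \o lift ord_max).
Proof.
move=> xd; rewrite lerD2l; apply: ler_sum => i _; rewrite ler_expR /=.
have : (lift ord_max i <= lift m i)%N by rewrite [leqLHS]lift_max leq_addl.
by rewrite leq_eqVlt => /orP[/eqP/val_inj <- //|lt]; exact/ltW/xd.
Qed.

(** Every index is shifted by one, so every term drops strictly; with n + 2 numbers at least one
    term remains. *)
Lemma exp_total_lift0_lt (R : realType) n (x : 'I_n.+2 -> R) :
  strictly_decreasing x ->
  exp_total (x \o lift ord0) < exp_total (x \o lift ord_max).
Proof.
move=> xd; rewrite ltrD2l; apply: ltr_sum => [|i _].
  by apply/hasP; exists ord0; rewrite ?mem_index_enum.
by rewrite ltr_expR; apply: xd; rewrite lift_max.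
Qed.

Lemma success_sum_recr_ge (R : realType) n (x : 'I_n.+1 -> R) m :
  strictly_decreasing x -> 1 <= success_sum (x \o lift m) ->
  exp_weight x m / exp_total (x \o lift m) <=
  success_sum (x \o lift m) * (exp_weight x m / exp_total (x \o lift m)).
Proof.
move=> xd S1; rewrite ler_peMl // ltW //.
by rewrite divr_gt0 ?exp_weight_gt0 ?exp_total_gt0.
Qed.

Lemma success_sum_ge1 (R : realType) n (x : 'I_n -> R) :
  strictly_decreasing x -> 1 <= success_sum x.
Proof.
elim: n x => [|n IHn] x xd.
  rewrite /success_sum (eq_bigr (fun=> 1)) => [|s _]; last by rewrite big_ord0.
  by rewrite sumr_const card_Sn.
rewrite success_sum_recr //.
(* Writing 1 as a quotient of equal totals and expanding the numerator into the weights permits a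
   termwise comparison. *)
rewrite -(divff (lt0r_neq0 (exp_total_gt0 (x \o lift ord_max)))).
rewrite -{1}sum_exp_weight mulr_suml; apply: ler_sum => m _.
apply: le_trans (success_sum_recr_ge xd (IHn _ (strictly_decreasing_lift m xd))).
rewrite ler_pM2l ?exp_weight_gt0 // lef_pV2 ?posrE ?exp_total_gt0 //.
exact: exp_total_lift_le.
Qed.

Lemma success_sum_gt1 (R : realType) n (x : 'I_n.+2 -> R) :
  strictly_decreasing x -> 1 < success_sum x.
Proof.
move=> xd; have D0 (y : 'I_n.+1 -> R) := exp_total_gt0 y.
have le_term m :=
  success_sum_recr_ge xd (success_sum_ge1 (strictly_decreasing_lift m xd)).
rewrite success_sum_recr // -(divff (lt0r_neq0 (D0 (x \o lift ord_max)))).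
rewrite -{1}sum_exp_weight mulr_suml.
(* The term [m = 0] is split off to supply the strict inequality. *)
rewrite big_ord_recl [ltRHS]big_ord_recl; apply: ltr_leD.
  apply: lt_le_trans (le_term _).
  by rewrite ltr_pM2l ?exp_weight_gt0 // ltf_pV2 ?posrE // exp_total_lift0_lt.
apply: ler_sum => m _; apply: le_trans (le_term _).
by rewrite ler_pM2l ?exp_weight_gt0 // lef_pV2 ?posrE // exp_total_lift_le.
Qed.

(** At [k = 0] the distribution lives on a single point, so its factor is 1. *)
Lemma success_sumE (R : realType) n (x : 'I_n -> R) :
  success_sum x = \sum_(s : 'S_n)
    \prod_(k < n | (0 < k)%N) exp_strategy (visible x s k) (lehmer s k).
Proof.
apply: eq_bigr => s _; rewrite [RHS]big_mkcond; apply: eq_bigr => k _.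
case: posnP => // k0; move: (visible x s k) (lehmer s k); rewrite k0 => eta c.
have /andP[_ /eqP] := simplexP (exp_strategy eta).
by rewrite big_ord1 (ord1 c).
Qed.

(** Given the permutation, only one vector of guesses wins, namely its Lehmer code. *)
Lemma win_probE (R : realType) (f : strategy R) n (x : 'I_n -> R) :
  win_prob f x = \sum_(s : 'S_n) (n`!%:R)^-1 *
    \prod_(k < n | (0 < k)%N) f _ (visible x s k) (lehmer s k).
Proof.
apply: eq_bigr => s _.
pose gs : guesses n := fprod_of_fun (fun k : stage n => lehmer s (val k)).
rewrite (big_pred1 gs) => [|g /=].
  rewrite /game_law (big_sub (fun k : 'I_n => (0 < k)%N)
    (fun k => f _ (visible x s k) (lehmer s k))).
  by congr (_ * _); apply: eq_bigr => k _; rewrite fprodE.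
apply/forallP/eqP => [w|-> k]; last by rewrite fprodE.
by apply/fprodP => k; rewrite fprodE; exact/eqP/w.
Qed.

Theorem theorem2 (R : realType) (n : nat) (hn : (2 <= n)%N) :
  dominant (@exp_strategy R) n /\
  (forall x : 'I_n -> R, strictly_decreasing x ->
     (n`!%:R)^-1 <
     \sum_(s : 'S_n) (n`!%:R)^-1 *
       \prod_(k < n | (0 < k)%N) exp_strategy (visible x s k) (lehmer s k)).
Proof.
suff H (x : 'I_n -> R) : strictly_decreasing x -> (n`!%:R)^-1 <
    \sum_(s : 'S_n) (n`!%:R)^-1 *
      \prod_(k < n | (0 < k)%N) exp_strategy (visible x s k) (lehmer s k).
  by split=> // x xd; rewrite win_probE; exact: H.
move=> xd; rewrite -mulr_sumr -success_sumE ltr_pMr; last first.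
  by rewrite invr_gt0 ltr0n fact_gt0.
case: n hn x xd => [|[|n]] // _ x xd; exact: success_sum_gt1.
Qed.
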